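(* Let $S:[0,+\infty)\to[0,+\infty]$ be a continuous increasing function, let $\tfrac12\le\lambda\le 1$, and let $n\ge 2$ be an integer. Suppose that $$\int_0^1 S(tx)(1-x^2)^{n-2}x\,dx\le t^{\lambda}\qquad\text{for all } t\in[0,+\infty).$$ Then $$\int_0^{+\infty}S(t)\,\frac{t^{2\lambda-1}}{(1+t^{2\lambda})^2}\,dt\ \le\ \frac{\pi(n-1)}{2\lambda}\prod_{k=1}^{n-1}\Bigl(1+\frac{\lambda}{2k}\Bigr).$$ Moreover, this estimate is sharp: for each such $\lambda$ and $n$, the right-hand side cannot be replaced by any smaller constant valid for all $S$ satisfying the hypotheses.
   Context: ''Increasing'' is meant in the non-strict sense: $x_1\le x_2$ implies $S(x_1)\le S(x_2)$. *)

(* Defs.v *)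
From HB Require Import structures.
From mathcomp Require Import all_boot all_order all_algebra.
From mathcomp Require Import all_classical all_reals all_analysis.

Set Implicit Arguments.
Unset Strict Implicit.
Unset Printing Implicit Defensive.

Import Order.TTheory GRing.Theory Num.Theory.
Import numFieldNormedType.Exports.

Local Open Scope classical_set_scope.
Local Open Scope ring_scope.

(* A function [0, +oo) -> [0, +oo] is encoded by a total [S : R -> \bar R] of
   which only the values on [0, +oo) are constrained or used. Continuity is for
   the subspace topology of [0, +oo) and the topology of the extended reals, so
   S may reach +oo. *)
Definition continuous_increasing (R : realType) (S : R -> \bar R) : Prop :=
  [/\ forall t : R, 0 <= t -> (0 <= S t)%E,
      {within `[0, +oo[, continuous S} &
      forall s t : R, 0 <= s -> s <= t -> (S s <= S t)%E].

Definition moment_bound (R : realType) (lambda : R) (n : nat)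
    (S : R -> \bar R) : Prop :=
  forall t : R, 0 <= t ->
  (\int[lebesgue_measure]_(x in `[0%R, 1%R])
      (S (t * x)%R * ((1 - x ^+ 2) ^+ (n - 2) * x)%R%:E)
    <= (t `^ lambda)%:E)%E.

Definition weighted_integral (R : realType) (lambda : R)
    (S : R -> \bar R) : \bar R :=
  (\int[lebesgue_measure]_(t in `[0%R, +oo[)
      (S t * (t `^ (2 * lambda - 1) / (1 + t `^ (2 * lambda)) ^+ 2)%R%:E))%E.

Definition bound_constant (R : realType) (lambda : R) (n : nat) : R :=
  pi * (n%:R - 1) / (2 * lambda) *
  \prod_(1 <= k < n) (1 + lambda / (2 * k%:R)).

(* Main.v *)
Require Import Defs.
From mathcomp Require Import all_boot all_order all_algebra.
From mathcomp Require Import all_classical all_reals all_analysis.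
From mathcomp Require Import measurable_realfun.
From mathcomp Require Import ring lra.

Set Implicit Arguments.
Unset Strict Implicit.
Unset Printing Implicit Defensive.

Import Order.TTheory GRing.Theory Num.Theory.
Import numFieldNormedType.Exports.

Local Open Scope classical_set_scope.
Local Open Scope ring_scope.

(** Let [J f u] be the integral of [f s * s] over [0 < s < u].  In the variable
    [s ^ 2] the moment of [S] is, up to a factor depending only on [t] and [n],
    the [(n - 1)]-fold iterate of [J], so the hypothesis says that [J^(n-1) S]
    is bounded by [J^(n-1) S0], where [S0 s = c * s^lambda] attains equality.
    The weight of the conclusion is [s * w s] with
    [w s = s^(2 lambda - 2) / (1 + s^(2 lambda))^2].  For [lambda <= 1], [w] is
    completely monotone in [s ^ 2], because the cone spanned by the functions
    [s^(-a) (1 + s^(2 lambda))^(-b)], [a >= 0], [b > 0], is stable under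
    [- (1 / s) d/ds].  Moving one derivative onto the weight turns one [f] into
    [J f] by Tonelli's theorem, so after [n - 1] steps the comparison of the
    iterates gives that of the weighted integrals, with equality for [S0]. *)

(** * Tonelli's theorem on the region [0 < s < u] *)

Section Wedge.
Context {R : realType}.
Notation mu := (@lebesgue_measure R).
Local Open Scope ereal_scope.
Implicit Types (f h : R -> \bar R) (b : itv_bound R).

(** Points are pairs (s, u). The upper bound on u is a parameter, so that one exchange formula
    serves both []0, +oo[] and []0, t[]. *)
Let wedge b : set (R * R) :=
  [set z | [/\ (0 < z.1)%R, (z.1 < z.2)%R & z.2 \in Interval -oo%O b]].

Let measurable_wedge b : measurable (wedge b).
Proof.
rewrite (_ : wedge b = (fst @^-1` `]0%R, +oo[%classic) `&`
    ((fun z : R * R => (z.1 < z.2)%R) @^-1` [set true]) `&`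
    (snd @^-1` [set` Interval -oo%O b])); last first.
  apply/seteqP; split => z /=; rewrite in_itv/= andbT; first by case.
  by case=> -[].
apply: measurableI; [apply: measurableI|]; rewrite -[X in measurable X]setTI.
- exact: measurable_fst.
- exact: measurable_fun_ltr.
- by apply: measurable_snd => //; exact: measurable_itv.
Qed.

Let wedge_kernel f h b : R * R -> \bar R :=
  (fun z => f z.1 * h z.2) \_ (wedge b).

Let measurable_wedge_kernel f h b : measurable_fun setT f ->
  measurable_fun setT h -> measurable_fun setT (wedge_kernel f h b).
Proof.
move=> mf mh; apply/(measurable_restrictT _ (measurable_wedge b)).
apply: measurable_funTS; apply: emeasurable_funM.
  exact: measurableT_comp mf measurable_fst.
exact: measurableT_comp mh measurable_snd.
Qed.

Let wedge_kernel_ge0 f h b : (forall x : R, (0 < x)%R -> 0 <= f x) ->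
  (forall x : R, (0 < x)%R -> 0 <= h x) -> forall z, 0 <= wedge_kernel f h b z.
Proof.
move=> f0 h0 z; rewrite /wedge_kernel patchE; case: ifPn => //.
rewrite inE => -[z1 z12 _]; apply: mule_ge0; first exact: f0.
by apply: h0; exact: lt_trans z12.
Qed.

(** Tonelli's theorem includes the measurability of section integrals; the sections here are those
    of the kernel with second factor 1 and u unbounded. *)
Lemma measurable_running_integral f : measurable_fun setT f ->
  (forall x : R, (0 < x)%R -> 0 <= f x) ->
  measurable_fun setT (fun u : R => \int[mu]_(s in `]0%R, u[) f s).
Proof.
move=> mf f0.
have := @measurable_fun_fubini_tonelli_G _ _ _ _ R mu (wedge_kernel f (cst 1) +oo%O)
  (measurable_wedge_kernel _ mf (measurable_cst _)).
move=> /(_ (wedge_kernel_ge0 _ f0 (fun _ _ => lee01))).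
apply: eq_measurable_fun => u _; rewrite /fubini_G [RHS]integral_mkcond.
apply: eq_integral => s _; rewrite /wedge_kernel !patchE mule1.
congr (if _ then _ else _); apply/idP/idP; rewrite !inE /= !in_itv/=.
  by case=> -> ->.
by move=> /andP[s0 su]; split.
Qed.

(** Both sides are iterated integrals of [wedge_kernel], taken in the two orders; it is nonnegative
    because the wedge contains only positive s and u. *)
Lemma integral_running_integral f h b : measurable_fun setT f ->
  measurable_fun setT h -> (forall x : R, (0 < x)%R -> 0 <= f x) ->
  (forall x : R, (0 < x)%R -> 0 <= h x) ->
  \int[mu]_(u in [set` Interval (BRight 0%R) b])
     ((\int[mu]_(s in `]0%R, u[) f s) * h u) =
  \int[mu]_(s in [set` Interval (BRight 0%R) b])
     (f s * \int[mu]_(u in [set` Interval (BRight s) b]) h u).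
Proof.
move=> mf mh f0 h0.
have mk := measurable_wedge_kernel b mf mh.
have k0 := wedge_kernel_ge0 b f0 h0.
have mS (i : interval R) (g : R -> \bar R) : measurable_fun setT g -> measurable_fun [set` i] g.
  exact: measurable_funTS.
rewrite [LHS]integral_mkcond [RHS]integral_mkcond.
transitivity (\int[mu]_u \int[mu]_s wedge_kernel f h b (s, u)).
  apply: eq_integral => u _; rewrite patchE; case: ifPn => [|uN].
    rewrite inE/= itv_boundlr/= => /andP[u0 ub].
    rewrite -ge0_integralZr//; last 3 first.
    - exact: mS.
    - by move=> x /=; rewrite in_itv/= => /andP[/f0].
    - exact: h0.
    rewrite integral_mkcond; apply: eq_integral => s _.
    rewrite /wedge_kernel !patchE/=.
    congr (if _ then _ else _); apply/idP/idP; rewrite !inE /= !in_itv/=.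
      by move=> /andP[s0 su]; split => //; rewrite itv_boundlr.
    by case=> -> ->.
  (* For u outside the interval the section of the wedge is empty, since [0 < s < u] already gives
     [0 < u]. *)
  apply/esym/integral0_eq => s _; rewrite /wedge_kernel patchE; case: ifPn => //.
  rewrite inE/= => -[s0 su ub]; exfalso; move: uN; rewrite notin_setE/=; apply.
  rewrite itv_boundlr/= bnd_simp (lt_trans s0 su)/=.
  by move: ub; rewrite itv_boundlr/=.
rewrite -fubini_tonelli//; apply: eq_integral => s _.
rewrite patchE; case: ifPn => [|sN].
  rewrite inE/= itv_boundlr/= => /andP[s0 sb].
  rewrite -ge0_integralZl//; last 3 first.
  - exact: mS.
  - move=> x /=; rewrite itv_boundlr/= => /andP[sx _].
    by apply: h0; exact: lt_trans sx.
  - exact: f0.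
  rewrite [RHS]integral_mkcond; apply: eq_integral => u _.
  rewrite /wedge_kernel !patchE/=.
  congr (if _ then _ else _); apply/idP/idP; rewrite !inE /= !itv_boundlr/=.
    by case=> _ + ub; rewrite bnd_simp => ->.
  by move=> /andP[su ub]; split.
apply: integral0_eq => u _; rewrite /wedge_kernel patchE; case: ifPn => //.
rewrite inE/= => -[s0 su ub]; exfalso; move: sN; rewrite notin_setE/=; apply.
rewrite itv_boundlr/= bnd_simp s0/=; move: ub; rewrite itv_boundlr/=.
by apply: le_trans; rewrite bnd_simp ltW.
Qed.

End Wedge.

(** * The weights [s^(-a) (1 + s^p)^(-b)] and their derivatives *)

Section Weight.
Context {R : realType}.
Notation mu := (@lebesgue_measure R).
Implicit Types p a b s u : R.

(** For [p = 2 l], [a = 2 - 2 l] and [b = 2], the product [s * weight p a b s] is, at [s > 0], the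
    weight in [weighted_integral l]. *)
Definition weight p a b s : R := s `^ (- a) * (1 + s `^ p) `^ (- b).

Lemma weight_ge0 p a b s : 0 <= weight p a b s.
Proof. by rewrite mulr_ge0// powR_ge0. Qed.

Lemma measurable_weight p a b : measurable_fun setT (weight p a b).
Proof.
apply: measurable_funM => //.
apply: (measurableT_comp (@measurable_powR R (- b))).
exact: measurable_funD.
Qed.

(** Minus the derivative of [weight p a b], arranged as s times a combination of two weights. *)
Definition weight_decay p a b s : R :=
  s * (a * weight p (a + 2) b s + p * b * weight p (a + 2 - p) (b + 1) s).

Lemma is_derive_weight p a b s : 0 < s ->
  is_derive s 1 (weight p a b) (- weight_decay p a b s).
Proof.
move=> s0.
have s1 : 0 < 1 + s `^ p by rewrite ltr_pwDl// powR_ge0.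
have d1 := is_derive1_powR (- a) s0.
have d2 : is_derive s 1 (fun u : R => 1 + u `^ p) (p * s `^ (p - 1)).
  have := is_deriveD (is_derive_cst (1 : R) s 1) (is_derive1_powR p s0).
  by rewrite add0r.
have d3 := @is_derive1_comp _ (@powR R ^~ (- b)) (fun u : R => 1 + u `^ p) _ _ _
  (is_derive1_powR (- b) s1) d2.
have := is_deriveM d1 d3; rewrite /weight => d4.
apply: is_derive_eq d4 _.
rewrite /weight_decay /weight /comp /GRing.scale/=.
have s_neq0 : s != 0 by rewrite gt_eqF.
(* Shifts of exponents by 1 become divisions by s, after which the identity is rational. *)
have powB1 x : s `^ (x - 1) = s `^ x / s.
  by rewrite powRB ?s_neq0 ?implybT// powRr1// ltW.
have -> : - (a + 2) = - a - 1 - 1 by ring.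
have -> : - (a + 2 - p) = - a + p - 1 - 1 by ring.
rewrite !powB1 (@powRD _ s (- a) p) ?s_neq0 ?implybT// opprD.
by field.
Qed.

Lemma cvgry_powR p : 0 < p -> x `^ p @[x --> +oo%R] --> +oo%R.
Proof.
move=> p0; apply/cvgryPge => A; near=> x.
apply: (le_trans (ler_norm A)).
have -> : `|A| = (`|A| `^ p^-1) `^ p.
  by rewrite -powRrM mulVf ?gt_eqF// powRr1.
apply: ge0_ler_powR; rewrite ?nnegrE ?powR_ge0 ?(ltW p0)//.
Unshelve. all: by end_near. Qed.

Lemma cvgr_powRN p : 0 < p -> x `^ (- p) @[x --> +oo%R] --> (0 : R).
Proof.
move=> p0; under eq_fun do rewrite powRN.
apply/(gtr0_cvgV0 _).2; last exact: cvgry_powR.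
by near=> x; rewrite powR_gt0.
Unshelve. all: by end_near. Qed.

(** For [x >= 1], [x^(-a) <= 1] and [(1 + x^p)^(-b) <= x^(-p b)], which tends to 0. *)
Lemma cvgr_weight p a b : 0 < p -> 0 <= a -> 0 < b ->
  weight p a b x @[x --> +oo%R] --> (0 : R).
Proof.
move=> p0 a0 b0; apply: (@squeeze_cvgr _ _ _ _ (cst 0) (fun x => x `^ (- (p * b)))).
- near=> x; rewrite weight_ge0/=.
  have x1 : 1 <= x by [].
  have xp0 : 0 < x `^ p by rewrite powR_gt0// (lt_le_trans _ x1).
  rewrite -mulrN powRrM -[leRHS]mul1r /weight ler_pM ?powR_ge0//.
    by rewrite -(powRr0 x) ler_powR// oppr_le0.
  rewrite !powRN lef_pV2 ?posrE ?powR_gt0 ?ltr_pwDr ?powR_ge0//.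
  by apply: ge0_ler_powR; rewrite ?nnegrE ?lerDr ?addr_ge0 ?powR_ge0// ltW.
- exact: cvg_cst.
- by apply: cvgr_powRN; rewrite mulr_gt0.
Unshelve. all: by end_near. Qed.

(** Fundamental theorem of calculus on a half-line: [- weight p a b] is a primitive of the
    nonnegative integrand and vanishes at infinity. *)
Lemma integral_weight_decay p a b s : 0 < p <= 2 -> 0 <= a -> 0 < b -> 0 < s ->
  (\int[mu]_(u in `]s, +oo[) (weight_decay p a b u)%:E = (weight p a b s)%:E)%E.
Proof.
move=> /andP[p0 p2] a0 b0 s0.
have dw q c d (x : R) : s <= x -> is_derive x 1 (weight q c d) (- weight_decay q c d x).
  by move=> sx; apply: is_derive_weight; exact: lt_le_trans sx.
have cw q c d (x : R) : s <= x -> {for x, continuous (weight q c d)}.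
  move=> /(dw q c d) [? _]; apply: differentiable_continuous.
  exact/derivable1_diffP.
have cwd (x : R) : s <= x -> {for x, continuous (weight_decay p a b)}.
  move=> sx; apply: continuousM; first exact: cvg_id.
  by apply: continuousD; apply: continuousM;
    [exact: cvg_cst|exact: cw|exact: cvg_cst|exact: cw].
rewrite integral_itv_obnd_cbnd; last first.
  apply/measurable_EFinP; apply: measurable_funTS.
  apply: measurable_funM => //; apply: measurable_funD;
    by apply: measurable_funM => //; exact: measurable_weight.
rewrite (@ge0_continuous_FTC2y _ _ (fun u => - weight p a b u) s 0).
- by rewrite EFinN oppeK add0e.
- move=> x sx; have x0 := lt_le_trans s0 sx.
  by rewrite mulr_ge0 ?(ltW x0)// addr_ge0// !mulr_ge0 ?powR_ge0 ?(ltW p0) ?(ltW b0).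
- apply/continuous_within_itvcyP; split.
    by move=> x; rewrite in_itv/= andbT => /ltW/cwd.
  by apply: cvg_at_right_filter; exact: cwd.
- by rewrite -oppr0; apply: cvgN; exact: cvgr_weight.
- by move=> x /ltW/(dw p a b)[? _]; exact: derivableN.
- by apply: cvgN; apply: cvg_at_right_filter; exact: cw.
- move=> x; rewrite in_itv/= andbT => /ltW/(dw p a b) d.
  by rewrite derive1E deriveN ?derive_val ?opprK//; case: d.
Qed.

End Weight.

(** * Primitives with respect to [s ds] and the comparison of weighted integrals *)

Section WeightedPrimitive.
Context {R : realType}.
Notation mu := (@lebesgue_measure R).
Local Open Scope ereal_scope.
Implicit Types (f g : R -> \bar R) (p a b s t u : R).

(** The operator J of the introduction: integration in the variable [s^2 / 2]. *)
Definition wprim f u : \bar R := \int[mu]_(s in `]0%R, u[) (f s * s%:E).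

Lemma wprim_ge0 f u : (forall x : R, (0 < x)%R -> 0 <= f x) -> 0 <= wprim f u.
Proof.
move=> f0; apply: integral_ge0 => s /=; rewrite in_itv/= => /andP[s0 _].
by rewrite mule_ge0 ?f0// lee_fin ltW.
Qed.

Let mulid_ge0 f : (forall x : R, (0 < x)%R -> 0 <= f x) ->
  forall x : R, (0 < x)%R -> 0 <= f x * x%:E.
Proof. by move=> f0 x x0; rewrite mule_ge0 ?f0// lee_fin ltW. Qed.

Let measurable_mulid f : measurable_fun setT f ->
  measurable_fun setT (fun x => f x * x%:E).
Proof.
by move=> mf; apply: emeasurable_funM => //; exact: measurableT_comp.
Qed.

Lemma measurable_wprim f : measurable_fun setT f ->
  (forall x : R, (0 < x)%R -> 0 <= f x) -> measurable_fun setT (wprim f).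
Proof.
by move=> mf f0; apply: measurable_running_integral;
  [exact: measurable_mulid|exact: mulid_ge0].
Qed.

(** Integration by parts without boundary terms, valid also for infinite integrals since it rests on
    Tonelli's theorem. *)
Lemma integral_wprim f (h : R -> \bar R) (b : itv_bound R) : measurable_fun setT f ->
  measurable_fun setT h -> (forall x : R, (0 < x)%R -> 0 <= f x) ->
  (forall x : R, (0 < x)%R -> 0 <= h x) ->
  \int[mu]_(u in [set` Interval (BRight 0%R) b]) (wprim f u * h u) =
  \int[mu]_(s in [set` Interval (BRight 0%R) b])
     (f s * (s%:E * \int[mu]_(u in [set` Interval (BRight s) b]) h u)).
Proof.
move=> mf mh f0 h0.
rewrite (integral_running_integral b (measurable_mulid mf) mh (mulid_ge0 f0) h0).
by apply: eq_integral => s _; rewrite muleA.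
Qed.

(** The weight at s is the integral of its decay over []s, +oo[]. Exchanging the integrals turns f
    into [wprim f], and the two summands of [weight_decay] give the two terms on the right. *)
Lemma integral_weight f p a b : (0 < p <= 2)%R -> (0 <= a)%R -> (0 < b)%R ->
  measurable_fun setT f -> (forall x : R, (0 < x)%R -> 0 <= f x) ->
  \int[mu]_(s in `]0%R, +oo[) (f s * (s * weight p a b s)%:E) =
  a%:E * (\int[mu]_(u in `]0%R, +oo[) (wprim f u * (u * weight p (a + 2) b u)%:E)) +
  (p * b)%:E * (\int[mu]_(u in `]0%R, +oo[)
                  (wprim f u * (u * weight p (a + 2 - p) (b + 1) u)%:E)).
Proof.
move=> p02 a0 b0 mf f0; have /andP[p0 p2] := p02.
have mw c d : measurable_fun setT (fun u : R => (u * weight p c d u)%:E).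
  by apply/measurable_EFinP; apply: measurable_funM => //; exact: measurable_weight.
have mfw c d : measurable_fun (`]0%R, +oo[%classic : set R)
    (fun u : R => wprim f u * (u * weight p c d u)%:E).
  apply: measurable_funTS; apply: emeasurable_funM => //.
  exact: measurable_wprim.
have fw0 c d (u : R) : (`]0%R, +oo[%classic : set R) u ->
    0 <= wprim f u * (u * weight p c d u)%:E.
  rewrite /= in_itv/= andbT => u0.
  by rewrite mule_ge0 ?wprim_ge0// lee_fin mulr_ge0 ?weight_ge0// ltW.
have pb0 : (0 <= p * b)%R by rewrite mulr_ge0// ltW.
rewrite -!ge0_integralZl_EFin//; try by [exact: fw0|exact: mfw].
rewrite -ge0_integralD//; [|
  by move=> u u0; rewrite mule_ge0 ?lee_fin ?fw0|
  by apply: measurable_funeM; exact: mfw|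
  by move=> u u0; rewrite mule_ge0 ?lee_fin ?fw0|
  by apply: measurable_funeM; exact: mfw].
transitivity (\int[mu]_(u in `]0%R, +oo[) (wprim f u * (weight_decay p a b u)%:E)).
  rewrite integral_wprim//.
  - apply: eq_integral => s; rewrite inE/= in_itv/= andbT => s0.
    by rewrite integral_weight_decay// EFinM.
  - apply/measurable_EFinP; apply: measurable_funM => //.
    by apply: measurable_funD; apply: measurable_funM => //; exact: measurable_weight.
  - move=> u u0; rewrite lee_fin /weight_decay.
    by rewrite mulr_ge0 ?(ltW u0)// addr_ge0// mulr_ge0 ?weight_ge0.
apply: eq_integral => u; rewrite inE/= in_itv/= andbT => u0.
rewrite muleCA [X in _ = _ + X]muleCA -!EFinM -ge0_muleDr ?lee_fin.
- by rewrite -EFinD; congr (_ * _%:E); rewrite /weight_decay; ring.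
- by rewrite !mulr_ge0 ?powR_ge0// ltW.
- by rewrite !mulr_ge0 ?powR_ge0// ltW.
Qed.

(* -d/d(s^2) maps the cone spanned by the weights with a >= 0 and b > 0 into
   itself; since a must stay nonnegative, this is where p <= 2 is used. *)
Lemma le_integral_weight k f g p a b :
  (0 < p <= 2)%R -> (0 <= a)%R -> (0 < b)%R ->
  measurable_fun setT f -> (forall x : R, (0 < x)%R -> 0 <= f x) ->
  measurable_fun setT g -> (forall x : R, (0 < x)%R -> 0 <= g x) ->
  (forall t, (0 < t)%R -> iter k wprim f t <= iter k wprim g t) ->
  \int[mu]_(s in `]0%R, +oo[) (f s * (s * weight p a b s)%:E) <=
  \int[mu]_(s in `]0%R, +oo[) (g s * (s * weight p a b s)%:E).
Proof.
move=> p02; have /andP[p0 p2] := p02.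
(* Each step replaces f and g by their primitives and changes both exponents, so all four are
   generalised. *)
elim: k f g a b => [|k IH] f g a b a0 b0 mf f0 mg g0 fg.
  apply: ge0_le_integral => //.
  - move=> s /=; rewrite in_itv/= andbT => s0.
    by rewrite mule_ge0 ?f0// lee_fin mulr_ge0 ?weight_ge0// ltW.
  - apply: measurable_funTS; apply: emeasurable_funM => //.
    by apply/measurable_EFinP; apply: measurable_funM => //; exact: measurable_weight.
  - apply: measurable_funTS; apply: emeasurable_funM => //.
    by apply/measurable_EFinP; apply: measurable_funM => //; exact: measurable_weight.
  - move=> s /=; rewrite in_itv/= andbT => s0.
    by rewrite lee_wpmul2r ?fg// lee_fin mulr_ge0 ?weight_ge0// ltW.
have fg' t : (0 < t)%R -> iter k wprim (wprim f) t <= iter k wprim (wprim g) t.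
  by rewrite -!iterSr; exact: fg.
have b1 : (0 < b + 1)%R by rewrite addr_gt0.
have a2 : (0 <= a + 2)%R by rewrite addr_ge0.
have ap : (0 <= a + 2 - p)%R by rewrite -addrA addr_ge0// subr_ge0.
have mwf := measurable_wprim mf f0; have mwg := measurable_wprim mg g0.
have wf0 u (_ : (0 < u)%R) := wprim_ge0 u f0.
have wg0 u (_ : (0 < u)%R) := wprim_ge0 u g0.
rewrite (integral_weight p02 a0 b0 mf f0) (integral_weight p02 a0 b0 mg g0).
apply: leeD; apply: lee_wpmul2l; rewrite ?lee_fin ?mulr_ge0 ?(ltW p0) ?(ltW b0)//.
  exact: (IH (wprim f) (wprim g)).
exact: (IH (wprim f) (wprim g)).
Qed.

End WeightedPrimitive.

(** * Cauchy's formula for iterated primitives, and scaling of integrals *)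

Section Kernel.
Context {R : realType}.
Notation mu := (@lebesgue_measure R).
Implicit Types (f g : R -> \bar R) (m k : nat) (s t u : R).

(** Cauchy's kernel [((t^2 - s^2) / 2)^m / m!] of the (m+1)-fold primitive in the variable
    [s^2 / 2]. *)
Definition kernel m t s : R := (t ^+ 2 - s ^+ 2) ^+ m / (2 ^+ m * m`!%:R).

Lemma measurable_kernel m t : measurable_fun setT (kernel m t).
Proof.
by apply: measurable_funM => //; apply: measurable_funX; apply: measurable_funB.
Qed.

Lemma kernel_ge0 m t s : 0 <= s -> s <= t -> 0 <= kernel m t s.
Proof.
move=> s0 st; rewrite divr_ge0 ?mulr_ge0 ?exprn_ge0// subr_ge0.
by rewrite lerXn2r ?nnegrE// (le_trans s0).
Qed.

Lemma is_derive_kernel m t s :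
  is_derive s 1 (kernel m.+1 t) (- (s * kernel m t s)).
Proof.
have d1 : is_derive s 1 (fun u : R => t ^+ 2 - u ^+ 2) (- (s *+ 2)).
  rewrite (_ : (fun u : R => _) = cst (t ^+ 2) - id ^+ 2); last first.
    by apply/funext => u; rewrite !fctE.
  have := is_deriveB (is_derive_cst (t ^+ 2) s 1) (is_deriveX 2 (is_derive_id s 1)).
  by move=> d; apply: is_derive_eq d _; rewrite /GRing.scale/= mulr1 expr1 sub0r mulr_natl.
have -> : kernel m.+1 t = (fun u : R => t ^+ 2 - u ^+ 2) ^+ m.+1 *
    cst (2 ^+ m.+1 * m.+1`!%:R)^-1.
  by apply/funext => u; rewrite /= !fctE.
have d2 := is_deriveM (is_deriveX m.+1 d1) 
  (is_derive_cst ((2 ^+ m.+1 * m.+1`!%:R)^-1 : R) s (1 : R)).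
apply: is_derive_eq d2 _.
rewrite /kernel /GRing.scale/= mulr0 add0r factS natrM exprS.
field.
by rewrite pnatr_eq0 -lt0n fact_gt0 expf_neq0 ?pnatr_eq0//= nat1r pnatr_eq0.
Qed.

Lemma continuous_kernel m t : continuous (kernel m t).
Proof.
(* The derivative formula covers positive exponents; for exponent 0 the kernel is constant. *)
move=> s; case: m => [|m]; last first.
  by apply: differentiable_continuous; apply/derivable1_diffP; case: (is_derive_kernel m t s).
rewrite (_ : kernel 0 t = cst 1); first exact: cvg_cst.
by apply/funext => u; rewrite /kernel !expr0 fact0 !mulr1 divr1.
Qed.

(** [- kernel m.+1 t] is a primitive of the integrand, and it vanishes at [u = t] because its
    exponent is positive. *)
Lemma integral_kernel m t s : s < t ->
  (\int[mu]_(u in `]s, t[) (u * kernel m t u)%:E = (kernel m.+1 t s)%:E)%E.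
Proof.
move=> st.
have ck : continuous (fun u : R => u * kernel m t u).
  by move=> u; apply: continuousM; [exact: cvg_id|exact: continuous_kernel].
rewrite -(@integral_itv_bndoo _ _ _ _ true false); last first.
  apply/measurable_EFinP; apply: measurable_funTS.
  exact: continuous_measurable_fun.
have dk := is_derive_kernel m t.
rewrite (@continuous_FTC2 _ _ (fun u => - kernel m.+1 t u))//.
- by rewrite -EFinB opprK {1}/kernel subrr expr0n/= mul0r oppr0 add0r.
- exact: continuous_subspaceT.
- split.
  + by move=> u _; have [? _] := dk u; exact: derivableN.
  + by apply: cvgN; apply: cvg_at_right_filter; exact: continuous_kernel.
  + by apply: cvgN; apply: cvg_at_left_filter; exact: continuous_kernel.
- move=> u _; have [? e] := dk u.
  by rewrite derive1E deriveN// e opprK.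
Qed.

(** Cauchy's formula for repeated integration. The induction peels off the innermost primitive and
    moves it onto the kernel, where [integral_kernel] raises the index. *)
Lemma iter_wprim m f t : 0 < t -> measurable_fun setT f ->
  (forall x : R, 0 < x -> (0 <= f x)%E) ->
  (iter m.+1 wprim f t =
   \int[mu]_(s in `]0%R, t[) (f s * (s * kernel m t s)%:E))%E.
Proof.
move=> t0; elim: m f => [|m IH] f mf f0.
  by apply: eq_integral => s _; rewrite /kernel !expr0 mulr1 divr1 mulr1.
rewrite iterSr IH; [|exact: measurable_wprim|by move=> x _; exact: wprim_ge0].
(* [integral_wprim] asks for a factor nonnegative at all positive u, while the kernel may be
   negative beyond t. The absolute value repairs this and changes nothing on []0, t[]. *)
pose h u : \bar R := (u * `|kernel m t u|)%:E.
have hE u : 0 < u < t -> h u = (u * kernel m t u)%:E.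
  by move=> /andP[u0 ut]; rewrite /h ger0_norm// kernel_ge0// ltW.
transitivity (\int[mu]_(u in `]0%R, t[) (wprim f u * h u))%E.
  by apply: eq_integral => u; rewrite inE/= in_itv/= => /hE ->.
rewrite integral_wprim//.
- apply: eq_integral => s; rewrite inE/= in_itv/= => /andP[s0 st].
  rewrite EFinM -integral_kernel//; congr (_ * (_ * _))%E.
  apply: eq_integral => u; rewrite inE/= in_itv/= => /andP[su ut].
  by rewrite hE// ut (lt_trans s0 su).
- apply/measurable_EFinP; apply: measurable_funM => //.
  by apply: measurableT_comp => //; exact: measurable_kernel.
- by move=> u u0; rewrite lee_fin mulr_ge0// ltW.
Qed.

(** Lebesgue measure is determined by its values on half-open intervals. Their preimages under
    multiplication by t are shorter by the factor t, which [mscale] restores. *)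
Lemma lebesgue_measure_scale t (t0 : 0 < t) (A : set R) : measurable A ->
  pushforward (mscale (NngNum (ltW t0)) mu)
    ( *%R t : _ -> measurableTypeR R) A = mu A.
Proof.
move=> mA; apply/esym/lebesgue_measure_unique => //= _ [[a b]] _ <-.
rewrite /pushforward /mscale/=.
have -> : *%R t @^-1` `]a, b] = `](a / t), (b / t)]%classic.
  apply/seteqP; split => x /=; rewrite !in_itv/=.
    by rewrite ltr_pdivrMr// ler_pdivlMr// ![_ * t]mulrC.
  by rewrite ltr_pdivrMr// ler_pdivlMr// ![_ * t]mulrC.
rewrite !lebesgue_measure_itv/= !lte_fin ltr_pM2r ?invr_gt0//.
case: ifPn => _; last by rewrite mule0.
rewrite -!EFinD -EFinM; congr _%:E.
by field; rewrite gt_eqF.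
Qed.

(** Change of variable [s = t x], with Lebesgue measure seen as the image of its multiple by t. *)
Lemma ge0_integral_scale t (f : R -> \bar R) : 0 < t ->
  measurable_fun setT f -> (forall x, 0 < x -> (0 <= f x)%E) ->
  (\int[mu]_(s in `]0%R, t[) f s = t%:E * \int[mu]_(x in `]0%R, 1%R[) f (t * x)%R)%E.
Proof.
move=> t0 mf f0.
have mt : measurable_fun setT ( *%R t : R -> measurableTypeR R) by exact: measurable_funM.
transitivity (\int[pushforward (mscale (NngNum (ltW t0)) mu)
    ( *%R t : _ -> measurableTypeR R)]_(s in `]0%R, t[) f s)%E.
  by apply: eq_measure_integral => A mA _; rewrite [RHS]lebesgue_measure_scale.
rewrite ge0_integral_pushforward//; last 2 first.
- exact: measurable_funTS.
- by move=> s; rewrite inE/= in_itv/= => /andP[/f0].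
have -> : *%R t @^-1` `]0%R, t[ = `]0%R, 1%R[%classic.
  by apply/seteqP; split => x /=; rewrite !in_itv/= pmulr_rgt0// gtr_pMr.
rewrite ge0_integral_mscale//.
- by apply: measurable_funTS; exact: measurableT_comp.
- by move=> x /=; rewrite in_itv/= => /andP[x0 _]; rewrite f0// mulr_gt0.
Qed.

End Kernel.

(** * Iterated primitives as moments, and explicit integrals of powers *)

Section Power.
Context {R : realType}.
Notation mu := (@lebesgue_measure R).
Implicit Types (f g : R -> \bar R) (m k : nat) (s t u l c : R).

(** Substitution [s = t x] in Cauchy's formula. For [m = n - 2] the integral on the right is that of
    [moment_bound], so the hypothesis bounds the (n-1)-fold primitive. *)
Lemma iter_wprim_scale m f t : 0 < t -> measurable_fun setT f ->
  (forall x : R, 0 < x -> (0 <= f x)%E) ->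
  (iter m.+1 wprim f t = (t ^+ (2 * m.+1) / (2 ^+ m * m`!%:R))%:E *
   \int[mu]_(x in `[0%R, 1%R]) (f (t * x)%R * ((1 - x ^+ 2) ^+ m * x)%:E))%E.
Proof.
move=> t0 mf f0; rewrite iter_wprim//.
(* The absolute value again gives nonnegativity on the whole positive axis, here for
   [ge0_integral_scale]. *)
pose h s : \bar R := (f s * `|s * kernel m t s|%:E)%E.
have mh : measurable_fun setT h.
  apply: emeasurable_funM => //; apply/measurable_EFinP.
  by apply: measurableT_comp => //; apply: measurable_funM => //; exact: measurable_kernel.
have h0 x : 0 < x -> (0 <= h x)%E by move=> x0; rewrite mule_ge0 ?f0// lee_fin.
transitivity (\int[mu]_(s in `]0%R, t[) h s)%E.
  apply: eq_integral => s; rewrite inE/= in_itv/= => /andP[s0 st].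
  by rewrite /h ger0_norm// mulr_ge0 ?kernel_ge0// ltW.
rewrite ge0_integral_scale//.
rewrite (@integral_itv_bndoo _ _ _ _ true false); last first.
  apply: measurable_funTS; apply: emeasurable_funM.
    by apply: measurableT_comp => //; exact: measurable_funM.
  apply/measurable_EFinP; apply: measurable_funM => //; apply: measurable_funX.
  exact: measurable_funB.
have c0 : 0 <= t ^+ (2 * m.+1) / (2 ^+ m * m`!%:R) by rewrite divr_ge0 ?exprn_ge0 ?mulr_ge0 ?ltW.
rewrite -!ge0_integralZl_EFin//; try exact: ltW.
- apply: eq_integral => x; rewrite inE/= in_itv/= => /andP[x0 x1].
  rewrite /h ger0_norm; last first.
    by rewrite mulr_ge0 ?kernel_ge0 ?mulr_ge0 ?ltW// gtr_pMr.
  rewrite muleCA [in RHS]muleCA -!EFinM; congr (_ * _%:E)%E.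
  rewrite /kernel exprMn -[X in (X - _) ^+ m]mulr1 -mulrBr exprMn -exprM.
  rewrite mulnS exprD; ring.
- move=> x /=; rewrite in_itv/= => /andP[x0 x1].
  rewrite mule_ge0 ?f0 ?mulr_gt0// lee_fin mulr_ge0 ?exprn_ge0 ?(ltW x0)//.
  by rewrite subr_ge0 exprn_ile1// ltW.
- apply: measurable_funTS; apply: emeasurable_funM.
    by apply: measurableT_comp => //; exact: measurable_funM.
  apply/measurable_EFinP; apply: measurable_funM => //; apply: measurable_funX.
  exact: measurable_funB.
- move=> x /=; rewrite in_itv/= => /andP[x0 x1].
  by rewrite h0// mulr_gt0.
- by apply: measurable_funTS; apply: measurableT_comp => //; exact: measurable_funM.
Qed.

Lemma cvg_powR0 c : 0 < c -> s `^ c @[s --> (0 : R)^'+] --> (0 : R) `^ c.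
Proof. by move=> c0; rewrite powR0 ?gt_eqF//; exact: powR_cvg0. Qed.

Lemma continuous_powR_gt0 c s : 0 < s -> {for s, continuous (@powR R ^~ c)}.
Proof.
move=> s0; apply: differentiable_continuous; apply/derivable1_diffP.
by apply: derivable_powR; rewrite in_itv/= s0.
Qed.

Lemma within_continuous_powR c : 0 < c ->
  {within `[0, +oo[, continuous (@powR R ^~ c)}.
Proof.
move=> c0; apply/continuous_within_itvcyP; split; last exact: cvg_powR0.
by move=> x; rewrite in_itv/= andbT => /continuous_powR_gt0; exact.
Qed.

Lemma integral_powR c t : 0 < c -> 0 < t ->
  (\int[mu]_(s in `]0%R, t[) (s `^ c)%:E = (t `^ (c + 1) / (c + 1))%:E)%E.
Proof.
move=> c0 t0; have c1 : 0 < c + 1 by rewrite addr_gt0.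
rewrite -(@integral_itv_bndoo _ _ _ _ true false); last first.
  by apply/measurable_EFinP; apply: measurable_funTS; exact: measurable_powR.
have dF s : 0 < s -> is_derive s 1 (fun s => s `^ (c + 1) / (c + 1)) (s `^ c).
  move=> s0.
  have d := is_deriveM (is_derive1_powR (c + 1) s0) (is_derive_cst ((c + 1)^-1 : R) s (1 : R)).
  apply: is_derive_eq d _.
  by rewrite /GRing.scale/= mulr0 add0r addrK mulrA mulVf ?mul1r// gt_eqF.
rewrite (@continuous_FTC2 _ _ (fun s => s `^ (c + 1) / (c + 1)))//.
- by rewrite powR0 ?gt_eqF// mul0r -EFinB subr0.
- apply: continuous_subspaceW (within_continuous_powR c0).
  by move=> x/=; rewrite !in_itv/= => /andP[->].
- split.
  + by move=> s; rewrite in_itv/= => /andP[/dF[]].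
  + by apply: cvgM; [exact: cvg_powR0|exact: cvg_cst].
  + by apply: cvgM; [apply: cvg_at_left_filter; exact: continuous_powR_gt0|exact: cvg_cst].
- by move=> s; rewrite in_itv/= => /andP[/dF[? d] _]; rewrite derive1E.
Qed.

(** Each primitive raises the exponent by 2 and divides by the new exponent, hence the factors
    [l + 2 j]. *)
Lemma iter_wprim_powR k l t : 0 < l -> 0 < t ->
  iter k wprim (fun s => (s `^ l)%:E) t =
  (t `^ (l + 2 * k%:R) / \prod_(1 <= j < k.+1) (l + 2 * j%:R))%:E.
Proof.
move=> l0; elim: k t => [|k IH] t t0.
  by rewrite /= big_geq// divr1 mulr0 addr0.
pose P : R := \prod_(1 <= j < k.+1) (l + 2 * j%:R).
have P0 : 0 <= P^-1.
  by rewrite invr_ge0 prodr_ge0// => j _; rewrite addr_ge0 ?mulr_ge0// ltW.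
rewrite iterS /wprim.
transitivity (\int[mu]_(s in `]0%R, t[) (P^-1%:E * (s `^ (l + 2 * k%:R + 1))%:E))%E.
  apply: eq_integral => s; rewrite inE/= in_itv/= => /andP[s0 _].
  rewrite IH// -!EFinM; congr _%:E.
  by rewrite (@powRD _ s (l + 2 * k%:R) 1) ?(gt_eqF s0) ?implybT// powRr1 ?(ltW s0)// /P; ring.
have e0 : 0 < l + 2 * k%:R + 1 by rewrite addr_gt0// ltr_pwDl// mulr_ge0.
rewrite ge0_integralZl_EFin//; last 2 first.
- by move=> x _; rewrite lee_fin powR_ge0.
- by apply/measurable_EFinP; apply: measurable_funTS; exact: measurable_powR.
rewrite integral_powR// -EFinM big_nat_recr//= -/P.
have -> : l + 2 * k%:R + 1 + 1 = l + 2 * k.+1%:R by rewrite -natr1; ring.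
by rewrite invfM; congr _%:E; ring.
Qed.

(** Supplies the primitive for [integral_extremal] in the variable [y = t^l]. *)
Lemma is_derive_atan_sub (y : R) :
  is_derive y 1 (fun y => atan y - y / (1 + y ^+ 2)) (2 * y ^+ 2 / (1 + y ^+ 2) ^+ 2).
Proof.
have y2 : 1 + y ^+ 2 != 0 by rewrite gt_eqF// ltr_pwDl// sqr_ge0.
have d1 : is_derive y 1 (fun u : R => 1 + u ^+ 2) (y *+ 2).
  rewrite (_ : (fun u : R => _) = cst 1 + id ^+ 2); last first.
    by apply/funext => u; rewrite !fctE.
  have d := is_deriveD (is_derive_cst (1 : R) y 1) (is_deriveX 2 (is_derive_id y (1 : R))).
  by apply: is_derive_eq d _; rewrite /GRing.scale/= mulr1 expr1 add0r mulr_natl.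
have d2 := @is_deriveV _ (fun u : R => 1 + u ^+ 2) _ _ _ y2 d1.
have d := is_deriveB (is_derive1_atan y) (is_deriveM (is_derive_id y 1) d2).
apply: is_derive_eq d _; rewrite /GRing.scale/=.
by field.
Qed.

(** With [y = t^l] the integral becomes [1 / l] times that of [y^2 / (1 + y^2)^2] over the
    half-line, which is [pi / 4]. *)
Lemma integral_extremal l : 2^-1 <= l ->
  (\int[mu]_(t in `[0%R, +oo[)
     ((t `^ l)%:E * (t `^ (2 * l - 1) / (1 + t `^ (2 * l)) ^+ 2)%:E) =
   (pi / (4 * l))%:E)%E.
Proof.
move=> l2; have l0 : 0 < l by apply: lt_le_trans l2; rewrite invr_gt0.
(* The exponent of t in the numerator of the product; its positivity makes the integrand continuous
   at 0. *)
have e0 : 0 < 3 * l - 1 by lra.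
have y2 (y : R) : 0 < 1 + y ^+ 2 by rewrite ltr_pwDl// sqr_ge0.
pose G (y : R) := atan y - y / (1 + y ^+ 2).
pose f s := s `^ (3 * l - 1) * ((1 + (s `^ l) ^+ 2) ^+ 2)^-1.
(* The factor [1 / (2 l)] cancels the 2 in the derivative of G and the l in that of [s^l]. *)
pose F s := (2 * l)^-1 * G (s `^ l).
have sq s : s `^ (2 * l) = (s `^ l) ^+ 2.
  by rewrite mulrC powRrM powR_mulrn ?powR_ge0.
have cG : continuous G.
  move=> y; apply: differentiable_continuous; apply/derivable1_diffP.
  by case: (is_derive_atan_sub y).
have cV : continuous (fun y : R => ((1 + y ^+ 2) ^+ 2)^-1).
  move=> y; apply: (@cvgV _ _ _ _ (fun y : R => (1 + y ^+ 2) ^+ 2)).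
    by rewrite expf_neq0// gt_eqF.
  apply: (@continuous_comp _ _ _ (fun y : R => 1 + y ^+ 2) (fun y => y ^+ 2)).
    by apply: cvgD; [exact: cvg_cst|exact: exprn_continuous].
  exact: exprn_continuous.
have dF s : 0 < s -> is_derive s 1 F (f s).
  move=> s0.
  have d := @is_derive1_comp _ G (@powR R ^~ l) _ _ _
    (is_derive_atan_sub (s `^ l)) (is_derive1_powR l s0).
  have {}d := is_deriveM (is_derive_cst ((2 * l)^-1 : R) s (1 : R)) d.
  apply: is_derive_eq d _; rewrite /GRing.scale/= mulr0 addr0 /f.
  have -> : 3 * l - 1 = 2 * l + (l - 1) by ring.
  rewrite (@powRD _ s (2 * l)) ?(gt_eqF s0) ?implybT// sq.
  by field; rewrite !gt_eqF.
transitivity (\int[mu]_(t in `[0%R, +oo[) (f t)%:E)%E.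
  (* At 0 both sides vanish thanks to [0^l = 0], even for [l = 1/2], where [0^(2 l - 1)] is 1. *)
  apply: eq_integral => s; rewrite inE/= in_itv/= andbT le_eqVlt => /predU1P[<-|s0].
    by rewrite /f (powR0 (lt0r_neq0 l0)) (powR0 (lt0r_neq0 e0)) mul0r mul0e.
  rewrite -EFinM /f sq mulrA -powRD ?(gt_eqF s0) ?implybT//.
  by congr (_ `^ _ / _)%:E; ring.
have cf s : 0 < s -> {for s, continuous f}.
  move=> s0; apply: (@cvgM _ _ _ _ (@powR R ^~ (3 * l - 1)) (fun s => ((1 + (s `^ l) ^+ 2) ^+ 2)^-1)).
    exact: continuous_powR_gt0.
  apply: (@continuous_comp _ _ _ (@powR R ^~ l) (fun y : R => ((1 + y ^+ 2) ^+ 2)^-1)).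
    exact: continuous_powR_gt0.
  exact: cV.
rewrite (@ge0_continuous_FTC2y _ _ F 0 (pi / (4 * l))).
- by rewrite /F powR0 ?gt_eqF// /G atan0 mul0r subrr mulr0 sube0.
- by move=> s _; rewrite mulr_ge0 ?powR_ge0 ?invr_ge0 ?exprn_ge0 ?(ltW (y2 _)).
- apply/continuous_within_itvcyP; split.
    by move=> s; rewrite in_itv/= andbT => /cf.
  apply: (@cvgM _ _ _ _ (@powR R ^~ (3 * l - 1)) (fun s => ((1 + (s `^ l) ^+ 2) ^+ 2)^-1)).
    exact: cvg_powR0.
  apply: (@cvg_comp _ _ _ (@powR R ^~ l) (fun y : R => ((1 + y ^+ 2) ^+ 2)^-1)).
    exact: cvg_powR0.
  exact: cV.
- have -> : pi / (4 * l) = (2 * l)^-1 * (pi / 2 - 0) :> R by field; rewrite gt_eqF.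
  apply: cvgM; first exact: cvg_cst.
  apply: (@cvgB _ _ _ _ _ (fun s => atan (s `^ l)) (fun s => s `^ l / (1 + (s `^ l) ^+ 2))).
    by apply: (@cvg_comp _ _ _ (@powR R ^~ l) (@atan R)); [exact: cvgry_powR|exact: cvgy_atan].
  (* With [y = s^l], [0 <= y / (1 + y^2) <= 1 / y]. *)
  apply: (@squeeze_cvgr _ _ _ _ (cst 0) (@powR R ^~ (- l))).
  + near=> s; rewrite divr_ge0 ?powR_ge0 ?(ltW (y2 _))//=.
    rewrite powRN ler_pdivrMr// mulrDr mulr1 expr2 mulKf ?lerDr ?invr_ge0 ?powR_ge0//.
    by rewrite gt_eqF// powR_gt0.
  + exact: cvg_cst.
  + exact: cvgr_powRN.
- by move=> s /dF[].
- apply: cvgM; first exact: cvg_cst.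
  by apply: (@cvg_comp _ _ _ (@powR R ^~ l) G); [exact: cvg_powR0|exact: cG].
- by move=> s; rewrite in_itv/= andbT => /dF[? d]; rewrite derive1E.
Unshelve. all: by end_near. Qed.

End Power.

(** * The extremal function and the comparison with it *)

Section Extremal.
Context {R : realType}.
Notation mu := (@lebesgue_measure R).
Implicit Types (S : R -> \bar R) (m n k : nat) (s t l : R).

(** Taking [2 j] out of each factor links the denominators of [iter_wprim_powR] to the product in
    [bound_constant]. *)
Lemma prod_addM2 l k : \prod_(1 <= j < k.+1) (l + 2 * j%:R) =
  2 ^+ k * k`!%:R * \prod_(1 <= j < k.+1) (1 + l / (2 * j%:R)) :> R.
Proof.
elim: k => [|k IH]; first by rewrite !big_geq// expr0 fact0 !mulr1.
rewrite big_nat_recr//= IH [in RHS]big_nat_recr//= factS natrM exprS -natr1; field.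
by rewrite ?natr1 ?nat1r pnatr_eq0.
Qed.

(** The reciprocal of the integral of [x^l (1 - x^2)^(n-2) x] over [[0, 1]], chosen to give equality
    in the moment bound. *)
Definition extremal_coef l n : R :=
  2 * (n%:R - 1) * \prod_(1 <= k < n) (1 + l / (2 * k%:R)).

Lemma extremal_coef_gt0 l n : 0 < l -> (2 <= n)%N -> 0 < extremal_coef l n.
Proof.
move=> l0 n2; rewrite mulr_gt0//; first by rewrite mulr_gt0// subr_gt0 ltr1n.
by apply: prodr_gt0 => k _; rewrite ltr_pwDl// divr_ge0 ?mulr_ge0 ?(ltW l0).
Qed.

Definition extremal l n s : \bar R := (extremal_coef l n * s `^ l)%:E.

Lemma measurable_extremal l n : measurable_fun setT (extremal l n).
Proof. by apply/measurable_EFinP; apply: measurable_funM. Qed.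

Lemma extremal_ge0 l n s : 0 < l -> (2 <= n)%N -> (0 <= extremal l n s)%E.
Proof.
by move=> l0 n2; rewrite lee_fin mulr_ge0 ?powR_ge0// ltW// extremal_coef_gt0.
Qed.

Lemma continuous_increasing_extremal l n : 0 < l -> (2 <= n)%N ->
  continuous_increasing (extremal l n).
Proof.
move=> l0 n2; split.
- by move=> t _; exact: extremal_ge0.
- have c : {within `[0, +oo[, continuous (fun s => extremal_coef l n * s `^ l)}.
    move=> s; apply: cvgM; first exact: cvg_cst.
    exact: within_continuous_powR.
  by move=> s; apply: cvg_EFin; [exact: nearW|exact: c].
- move=> s t s0 st; rewrite lee_fin ler_pM2l ?extremal_coef_gt0//.
  by apply: ge0_ler_powR; rewrite ?nnegrE ?(ltW l0)// (le_trans s0).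
Qed.

(** Homogeneity takes out [t^l]. The remaining integral follows from two evaluations at 1 of the
    (n-1)-fold primitive of [s^l]: as a moment, and by the explicit formula for powers. *)
Lemma moment_extremal l n t : 0 < l -> (2 <= n)%N -> 0 <= t ->
  (\int[mu]_(x in `[0%R, 1%R])
      (extremal l n (t * x) * ((1 - x ^+ 2) ^+ (n - 2) * x)%:E) = (t `^ l)%:E)%E.
Proof.
move=> l0 n2 t0; have c0 := extremal_coef_gt0 l0 n2.
case: n n2 c0 => [//|[//|m]] _ c0; rewrite !subSS subn0.
pose w (x : R) : \bar R := ((x `^ l)%:E * ((1 - x ^+ 2) ^+ m * x)%:E)%E.
have mw : measurable_fun setT w.
  apply: emeasurable_funM; first by apply/measurable_EFinP; exact: measurable_powR.
  apply/measurable_EFinP; apply: measurable_funM => //; apply: measurable_funX.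
  exact: measurable_funB.
have w0 (x : R) : `[0%R, 1%R]%classic x -> (0 <= w x)%E.
  rewrite /= in_itv/= => /andP[x0 x1]; rewrite /w -EFinM lee_fin.
  by rewrite !mulr_ge0 ?powR_ge0 ?exprn_ge0// subr_ge0 exprn_ile1.
transitivity ((extremal_coef l m.+2 * t `^ l)%:E * \int[mu]_(x in `[0%R, 1%R]) w x)%E.
  rewrite -ge0_integralZl_EFin//; last 2 first.
  - exact: measurable_funTS.
  - by rewrite mulr_ge0 ?powR_ge0// ltW.
  apply: eq_integral => x; rewrite inE/= in_itv/= => /andP[x0 x1].
  by rewrite /extremal /w powRM// -!EFinM; congr _%:E; ring.
have := @iter_wprim_scale _ m (fun s => (s `^ l)%:E) 1 ltr01.
rewrite (iter_wprim_powR m.+1 l0 ltr01) powR1 !expr1n prod_addM2.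
under eq_integral do rewrite mul1r.
rewrite -/w => /(_ _ _)/esym e.
have {e} : ((1 / (2 ^+ m * m`!%:R))%:E * \int[mu]_(x in `[0%R, 1%R]) w x)%E =
    (1 / (2 ^+ m.+1 * (m.+1)`!%:R * \prod_(1 <= j < m.+2) (1 + l / (2 * j%:R))))%:E.
  apply: e; first by apply/measurable_EFinP; exact: measurable_powR.
  by move=> x _; rewrite lee_fin powR_ge0.
set P := \prod_(1 <= j < m.+2) _ => e.
have P0 : P != 0.
  by move: c0; rewrite /extremal_coef -/P; apply: contraTneq => ->; rewrite mulr0 ltxx.
have f0 : m`!%:R != 0 :> R by rewrite pnatr_eq0 -lt0n fact_gt0.
have p0 : 2 ^+ m != 0 :> R by rewrite expf_neq0.
have m0 : m.+1%:R != 0 :> R by rewrite pnatr_eq0.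
(* Isolates the factor [1 / (2^m m!)] that accompanies the integral in [e]. *)
have -> : extremal_coef l m.+2 * t `^ l =
    (2 * m.+1%:R * P * t `^ l * (2 ^+ m * m`!%:R)) * (1 / (2 ^+ m * m`!%:R)).
  rewrite /extremal_coef -/P -[m.+2%:R]natr1 addrK.
  by field; rewrite f0 p0.
rewrite EFinM -muleA e -EFinM factS natrM exprS; congr _%:E.
by field; rewrite P0 f0 p0 nat1r m0.
Qed.

Lemma weighted_integral_extremal l n : 2^-1 <= l -> (2 <= n)%N ->
  weighted_integral l (extremal l n) = (bound_constant l n)%:E.
Proof.
move=> l2 n2; have l0 : 0 < l by apply: lt_le_trans l2; rewrite invr_gt0.
have c0 := extremal_coef_gt0 l0 n2.
transitivity ((extremal_coef l n)%:E * (pi / (4 * l))%:E)%E; last first.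
  rewrite -EFinM /extremal_coef /bound_constant; congr _%:E.
  by field; rewrite gt_eqF.
rewrite -(integral_extremal l2) -ge0_integralZl_EFin//; last 3 first.
- move=> x _; rewrite -EFinM lee_fin mulr_ge0 ?powR_ge0// divr_ge0 ?powR_ge0//.
  by rewrite exprn_ge0// addr_ge0 ?powR_ge0.
- apply: measurable_funTS; rewrite /=.
  apply: emeasurable_funM; first by apply/measurable_EFinP; exact: measurable_powR.
  apply/measurable_EFinP; apply: measurable_funM => //.
  (* The inverse square is written as a real power, whose measurability is known. *)
  have -> : (fun t : R => ((1 + t `^ (2 * l)) ^+ 2)^-1) =
      (fun y : R => (1 + y) `^ (- 2%:R)) \o (@powR R ^~ (2 * l)).
    by apply/funext => t /=; rewrite powR_invn// addr_ge0 ?powR_ge0.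
  apply: measurableT_comp => //.
  by apply: (measurableT_comp (@measurable_powR R _)); exact: measurable_funD.
- exact: ltW.
by apply: eq_integral => t _; rewrite /extremal EFinM muleA.
Qed.

(** Closed upper rays generate the measurable sets, and their preimages under a monotone function
    are intervals. *)
Lemma measurable_nondecreasing_ereal S :
  (forall s t, s <= t -> (S s <= S t)%E) -> measurable_fun setT S.
Proof.
move=> ndS mD; apply: (measurability _ (ErealGenCInfty.measurableE R)) => //.
move=> _ [_ [r ->] <-]; rewrite setTI.
apply: is_interval_measurable => s t/=.
rewrite !in_itv/= !andbT => rs rt u /andP[su ut].
by rewrite in_itv/= andbT (le_trans rs)// ndS.
Qed.

Lemma weighted_integral_le l n S : 2^-1 <= l -> l <= 1 -> (2 <= n)%N ->
  continuous_increasing S -> moment_bound l n S ->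
  (weighted_integral l S <= weighted_integral l (extremal l n))%E.
Proof.
move=> l2 l1 n2 [S0 _ ndS] mS; have l0 : 0 < l by apply: lt_le_trans l2; rewrite invr_gt0.
(* S is controlled only on [[0, +oo[]; extended by 0 to the left it is monotone on the whole line,
   hence measurable. *)
pose f : R -> \bar R := S \_ `]0%R, +oo[.
have fE s : 0 < s -> f s = S s by move=> s0; rewrite /f patchE mem_set//= in_itv/= s0.
have fE0 s : s <= 0 -> f s = 0%E.
  by move=> s0; rewrite /f patchE memNset//= in_itv/= andbT => /lt_geF; rewrite s0.
have f0 s : (0 <= f s)%E.
  by have [/fE0->//|s0] := leP s 0; rewrite fE// S0// ltW.
have mf : measurable_fun setT f.
  apply: measurable_nondecreasing_ereal => s t st.
  have [/fE0->//|s0] := leP s 0.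
  by rewrite !fE ?(lt_le_trans s0)// ndS// ltW.
(* The null point 0 is dropped and the integrand put in the form of [le_integral_weight]. *)
have wE h : measurable_fun (`]0%R, +oo[%classic : set R) h -> weighted_integral l h =
    (\int[mu]_(s in `]0%R, +oo[) (h s * (s * weight (2 * l) (2 - 2 * l) 2 s)%:E))%E.
  move=> mh; have e s : 0 < s ->
      (h s * (s `^ (2 * l - 1) / (1 + s `^ (2 * l)) ^+ 2)%:E)%E =
      (h s * (s * weight (2 * l) (2 - 2 * l) 2 s)%:E)%E.
    move=> s0; congr (_ * _%:E)%E.
    rewrite /weight powR_invn ?addr_ge0 ?powR_ge0// mulrA; congr (_ / _).
    rewrite -{2}(powRr1 (ltW s0)) -powRD ?(gt_eqF s0) ?implybT//.
    by congr (_ `^ _); ring.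
  rewrite /weighted_integral -integral_itv_obnd_cbnd; last first.
    apply: (eq_measurable_fun (fun s => h s * (s * weight (2 * l) (2 - 2 * l) 2 s)%:E)%E).
      by move=> s; rewrite inE/= in_itv/= andbT => /e.
    apply: emeasurable_funM => //; apply/measurable_EFinP; apply: measurable_funTS.
    by apply: measurable_funM => //; exact: measurable_weight.
  by apply: eq_integral => s; rewrite inE/= in_itv/= andbT => /e.
have mg := @measurable_extremal l n.
have Sf s : `]0%R, +oo[%classic s -> S s = f s.
  by rewrite /= in_itv/= andbT => /fE.
rewrite (wE (extremal l n)); last exact: measurable_funTS.
rewrite (wE S); last first.
  by apply: (eq_measurable_fun f); [move=> s; rewrite inE => /Sf|exact: measurable_funTS].
have -> : (\int[mu]_(s in `]0%R, +oo[) (S s * (s * weight (2 * l) (2 - 2 * l) 2 s)%:E) =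
    \int[mu]_(s in `]0%R, +oo[) (f s * (s * weight (2 * l) (2 - 2 * l) 2 s)%:E))%E.
  by apply: eq_integral => s; rewrite inE => /Sf ->.
(* Here [p = 2 l], [a = 2 - 2 l] and [b = 2]; both [p <= 2] and [a >= 0] amount to [l <= 1]. *)
apply: (@le_integral_weight _ n.-1) => //.
- by apply/andP; split; lra.
- lra.
- by move=> s _; exact: extremal_ge0.
move=> t t0; case: n n2 mS mg {wE} => [//|[//|m]] n2 mS mg.
rewrite -pred_Sn !iter_wprim_scale//; last by move=> s _; exact: extremal_ge0.
apply: lee_wpmul2l.
  by rewrite lee_fin divr_ge0 ?exprn_ge0 ?mulr_ge0 ?ltW.
have := moment_extremal l0 n2 (ltW t0); rewrite !subSS subn0 => ->.
have := mS t (ltW t0); rewrite !subSS subn0; apply: le_trans.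
rewrite le_eqVlt; apply/orP; left; apply/eqP.
(* At [x = 0], where f and S may differ, the factor x makes both integrands vanish. *)
apply: eq_integral => x; rewrite inE/= in_itv/= le_eqVlt => /andP[/predU1P[<-|x0] _].
  by rewrite !mulr0 !mule0.
by rewrite fE// mulr_gt0.
Qed.

End Extremal.

(** * The inequality and its optimality *)

Theorem mainTheorem1 (R : realType) (lambda : R) (n : nat)
    (lambda_ge : 2^-1 <= lambda) (lambda_le : lambda <= 1) (n_ge2 : (2 <= n)%N) :
  (forall S : R -> \bar R,
      continuous_increasing S -> moment_bound lambda n S ->
      (weighted_integral lambda S <= (bound_constant lambda n)%:E)%E) /\
  (forall C : R, C < bound_constant lambda n ->
      ~ (forall S : R -> \bar R,
            continuous_increasing S -> moment_bound lambda n S ->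
            (weighted_integral lambda S <= C%:E)%E)).
Proof.
have l0 : 0 < lambda by apply: lt_le_trans lambda_ge; rewrite invr_gt0.
have extE := weighted_integral_extremal lambda_ge n_ge2.
split=> [S cS mS|C ltC bndC].
  by rewrite -extE; exact: weighted_integral_le.
(* The extremal function is admissible and its weighted integral equals the bound, so no smaller C
   can be valid. *)
have := bndC _ (continuous_increasing_extremal l0 n_ge2).
rewrite extE lee_fin leNgt ltC => /(_ _)/negP; apply=> //.
by move=> t t0; rewrite moment_extremal.
Qed.
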